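(* Let $\Gamma$ be a finite undirected graph without self-loops and multiple edges, with $r$ vertices and $s$ edges, and let $t$ be the number of connected components of $\Gamma$ that are bipartite. Let $\mathbf{k}$ be a function assigning to each vertex $\lambda$ an integer $k_\lambda\ge1$. Then the rank of the Abelian group $D_{\mathbf{k}}(\Gamma)$ is $s-r+t$.
   Context: With the vertices of $\Gamma$ identified with $1,\dots,r$, let $F_{\mathbf{k}}(\Gamma)$ be the free Abelian group on symbols $b_{\lambda,\mu}$, $1\le\lambda,\mu\le r$, and $R_{\mathbf{k}}(\Gamma)\subset F_{\mathbf{k}}(\Gamma)$ the subgroup generated by (1) $b_{\lambda,\mu}-b_{\mu,\lambda}$ for $\lambda<\mu$; (2) $b_{\lambda,\mu}$ whenever there is no edge between $\lambda$ and $\mu$ (in particular $b_{\lambda,\lambda}$); (3) $\sum_{\lambda\neq\mu}k_\lambda b_{\lambda,\mu}$ for each $\mu$. Then $D_{\mathbf{k}}(\Gamma)=F_{\mathbf{k}}(\Gamma)/R_{\mathbf{k}}(\Gamma)$. A graph consisting of a single vertex counts as bipartite. *)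

(* Defs.v *)
From HB Require Import structures.
From mathcomp Require Import all_boot all_order all_algebra.
From mathcomp Require Import boolp.
From mathcomp.multinomials Require Import freeg.

Set Implicit Arguments.
Unset Strict Implicit.
Unset Printing Implicit Defensive.

Import GRing.Theory.
Local Open Scope ring_scope.

(* The intersection of all subgroups containing [X]. *)
Definition subgroup_gen (M : zmodType) (X : M -> Prop) : {pred M} :=
  fun x => `[< forall H : {pred M},
                 zmod_closed H -> (forall y, X y -> y \in H) -> x \in H >].

Lemma subgroup_gen_zmod_closed (M : zmodType) (X : M -> Prop) :
  zmod_closed (subgroup_gen X).
Proof.
split=> [|x y xX yX]; apply/asboolP=> H HZ HX; case: (HZ) => H0 HB; first exact: H0.
by move/asboolP/(_ H HZ HX): xX => xH; move/asboolP/(_ H HZ HX): yX; exact: HB.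
Qed.

HB.instance Definition _ (M : zmodType) (X : M -> Prop) :=
  GRing.isZmodClosed.Build M (subgroup_gen X) (subgroup_gen_zmod_closed X).

Definition Zindependent (A : zmodType) (n : nat) (v : 'I_n -> A) : Prop :=
  forall c : 'I_n -> int, \sum_(i < n) v i *~ c i = 0 -> forall i, c i = 0.

(* [A] has finite (torsion-free) rank [n]: the largest cardinality of a
   Z-linearly independent family is [n]. *)
Definition has_rank (A : zmodType) (n : nat) : Prop :=
  (exists v : 'I_n -> A, Zindependent v) /\
  (forall (m : nat) (v : 'I_m -> A), Zindependent v -> (m <= n)%N).

(* A simple graph on the vertex set {1, ..., r} is given by its adjacency
   relation [e] on ['I_r]; symmetry and irreflexivity are hypotheses of the
   theorem, not of the definitions below. *)

Definition edges (r : nat) (e : rel 'I_r) : {set {set 'I_r}} :=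
  [set [set p.1; p.2] | p : 'I_r * 'I_r & e p.1 p.2].

Definition components (r : nat) (e : rel 'I_r) : {set {set 'I_r}} :=
  equivalence_partition (connect e) [set: 'I_r].

(* [A] and its complement are the two colour classes; they may be empty, so
   that a single vertex is bipartite. *)
Definition bipartite (r : nat) (e : rel 'I_r) (C : {set 'I_r}) : bool :=
  [exists A : {set 'I_r},
    [forall x in C, forall y in C, e x y ==> ((x \in A) != (y \in A))]].

Definition F (r : nat) : zmodType := {freeg ('I_r * 'I_r)%type}.

Definition b (r : nat) (l m : 'I_r) : F r := << (l, m) >>.

Inductive relator (r : nat) (e : rel 'I_r) (k : 'I_r -> int) : F r -> Prop :=
| relator_sym (l m : 'I_r) of (l < m)%N : relator e k (b l m - b m l)
| relator_nonedge (l m : 'I_r) of ~~ e l m : relator e k (b l m)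
| relator_sum (m : 'I_r) : relator e k (\sum_(l < r | l != m) b l m *~ k l).

Definition D (r : nat) (e : rel 'I_r) (k : 'I_r -> int) : zmodType :=
  Quotient.quot (subgroup_gen (relator e k)).

(* Main.v *)
(* Modulo the first two kinds of relators, F is free on the s edges, so the rank
   of D is s minus the rank of the r x s rational matrix whose rows are the
   third relators.  The row kernel of that matrix consists of the y such that
   y_l k_m + y_m k_l = 0 for every edge {l, m}; equivalently z_l = y_l / k_l
   changes sign along every edge.  On each component such a z has constant
   absolute value, and it can be nonzero exactly when the component is
   bipartite, in which case it is a multiple of the signing given by a
   2-colouring.  Hence the kernel has dimension t and the matrix rank r - t. *)
From HB Require Import structures.
Require Import Defs.
From mathcomp Require Import all_boot all_order all_algebra.
From mathcomp Require Import boolp.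
From mathcomp.multinomials Require Import freeg.
Import GRing.Theory Num.Theory.
Local Open Scope ring_scope.
Local Open Scope quotient_scope.
Set Implicit Arguments.
Unset Strict Implicit.
Unset Printing Implicit Defensive.

(** * Rank of a quotient group as the rank of a rational matrix *)

Lemma rV_clear_denominators (n : nat) (y : 'rV[rat]_n) :
  exists2 d : int, d != 0 &
    exists z : 'I_n -> int, forall i, d%:~R * y 0 i = (z i)%:~R.
Proof.
exists (\prod_i denq (y 0 i));
  first by apply/prodf_neq0=> i _; exact: denq_neq0.
exists (fun i => numq (y 0 i) * \prod_(j | j != i) denq (y 0 j)) => i.
rewrite (bigD1 i) //= !rmorphM /= -[X in _ * X = _]divq_num_den.
by rewrite [LHS]mulrC mulrA divfK // intr_eq0 denq_neq0.
Qed.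

Section QuotientRank.
Variables (A : zmodType) (S : zmodClosed A).

Lemma pi_quot_eq0 (x : A) : (\pi_(Quotient.quot S) x == 0) = (x \in S).
Proof. by rewrite -[x in RHS]subr0 Quotient.idealrBE [\pi 0]raddf0. Qed.

Variables (s m : nat) (T : {additive A -> 'rV[rat]_s}).
Variables (u : 'I_m -> A) (K : 'M[rat]_(m, s)).
Hypothesis T_sub : forall x, (T x <= K)%MS.
Hypothesis T_u : forall i, T (u i) = row i K.
Hypothesis T_eq0 : forall x, T x = 0 <-> exists2 d : int, d != 0 & x *~ d \in S.

(** By [T_eq0], [T] factors through the quotient by [S] and kills there exactly the torsion. Integer
    independence in the quotient thus becomes rational independence in the row space of [K], which
    the images of the [u i] span. *)
Lemma has_rank_quot : has_rank (Quotient.quot S) (\rank K).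
Proof.
split.
  (* [f] selects rows of [K] forming a basis of its row space; the matching [u (f i)] give the
     independent family. *)
  pose f := maxrankfun K.
  exists (fun i => \pi_(Quotient.quot S) (u (f i))) => c c0 i.
  have {c0} : \sum_i u (f i) *~ c i \in S.
    rewrite -pi_quot_eq0 raddf_sum /= -[X in _ == X]c0; apply/eqP.
    by apply: eq_bigr => j _; rewrite raddfMz.
  move=> cS; have : T (\sum_i u (f i) *~ c i) = 0.
    by apply/T_eq0; exists 1; rewrite ?mulr1z.
  rewrite raddf_sum /=.
  have -> : \sum_i T (u (f i) *~ c i) = (\row_i (c i)%:~R) *m rowsub f K.
    rewrite mulmx_sum_row; apply: eq_bigr => j _.
    by rewrite raddfMz /= T_u row_rowsub mxE scaler_int.
  move/eqP; rewrite mulmx_free_eq0 ?maxrowsub_free // => /eqP/rowP/(_ i).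
  by rewrite !mxE => /eqP; rewrite intr_eq0 => /eqP.
move=> p v v_ind; rewrite leqNgt; apply/negP => lt_Kp.
(* More than [\rank K] rows in the row space of [K] are dependent. Clearing denominators gives
   integers [z], and [T_eq0] a further factor [q], so that the [z i * q] are a forbidden relation
   among the [v i]. *)
pose V : 'M_(p, s) := \matrix_i T (repr (v i)).
have V_sub : (V <= K)%MS by apply/row_subP => i; rewrite rowK.
have V_nfree : ~~ row_free V.
  by apply/negP => /eqP rV; move: (mxrankS V_sub); rewrite rV leqNgt lt_Kp.
move: V_nfree; rewrite -kermx_eq0 => /rowV0Pn[y /sub_kermxP yV y_neq0].
have [d d_neq0 [z zE]] := rV_clear_denominators y.
have : T (\sum_i repr (v i) *~ z i) = 0.
  transitivity (d%:~R *: (y *m V)); last by rewrite yV scaler0.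
  rewrite raddf_sum scalemxAl mulmx_sum_row.
  by apply: eq_bigr => j _; rewrite raddfMz /= rowK mxE zE scaler_int.
case/T_eq0 => q q_neq0; rewrite -pi_quot_eq0 mulrz_suml raddf_sum /=.
move=> /eqP vz0.
have zq0 i : z i * q = 0.
  apply: (v_ind (fun i => z i * q)); apply: etrans vz0; apply: eq_bigr => j _.
  by rewrite -mulrzA raddfMz /= reprK.
case/negP: y_neq0; apply/eqP/rowP => i; rewrite mxE.
have /eqP := zq0 i; rewrite mulf_eq0 (negPf q_neq0) orbF => /eqP zi0.
have /eqP := zE i; rewrite zi0 mulf_eq0 intr_eq0 (negPf d_neq0) => /eqP //.
Qed.

End QuotientRank.

(** * Edge coordinates and the matrix of the third relators *)

Section Relators.
Variables (r : nat) (e : rel 'I_r) (k : 'I_r -> int).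
Hypotheses (e_sym : symmetric e) (e_irrefl : irreflexive e).

Let swap (p : 'I_r * 'I_r) := (p.2, p.1).

Definition oriented_edges : {set 'I_r * 'I_r} :=
  [set p : 'I_r * 'I_r | (p.1 < p.2)%N && e p.1 p.2].

Lemma card_oriented_edges : #|oriented_edges| = #|edges e|.
Proof.
have -> : edges e = [set [set p.1; p.2] | p in oriented_edges].
  apply/setP=> X; apply/imsetP/imsetP=> -[[x y] /=].
    rewrite inE /= => exy ->.
    case: (ltngtP x y) => [lt_xy|lt_yx|/ord_inj eq_xy].
    - by exists (x, y); rewrite // inE /= lt_xy.
    - exists (y, x); last exact: setUC.
      by rewrite inE /= lt_yx e_sym.
    - by move: exy; rewrite eq_xy e_irrefl.
  by rewrite inE => /andP[_ exy] ->; exists (x, y); rewrite ?inE.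
rewrite card_in_imset // => -[x y] [x' y']; rewrite !inE /=.
move=> /andP[xy _] /andP[x'y' _] /setP eqXY.
have := eqXY x; have := eqXY y; have := eqXY x'; rewrite !inE !eqxx !orbT /=.
rewrite (eq_sym x x'); case: (eqVneq x' x) => [->|_] /=.
  by move=> _ /esym/orP[/eqP yx|/eqP ->] //; move: xy; rewrite yx ltnn.
(* The crossed matching would give x < y = x' < y' = x. *)
move=> /eqP x'y _ /esym/eqP xy'; rewrite x'y -xy' in x'y'.
by move: (ltn_trans xy x'y'); rewrite ltnn.
Qed.

(* The coordinates of the image of [x] in the quotient of [F r] by the first
   two kinds of relators, which is free on the edges. *)
Definition edge_coord (x : F r) : 'rV[rat]_#|oriented_edges| :=
  \row_i (coeff (enum_val i) x + coeff (swap (enum_val i)) x)%:~R.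

Fact edge_coord_is_zmod_morphism : zmod_morphism edge_coord.
Proof.
move=> x y; apply/rowP=> i; rewrite !mxE !coeffB -rmorphB /=.
by rewrite opprD addrACA.
Qed.
HB.instance Definition _ := GRing.isZmodMorphism.Build (F r)
  'rV[rat]_#|oriented_edges| edge_coord edge_coord_is_zmod_morphism.

Lemma edge_coord_b (l m : 'I_r) i :
  edge_coord (b l m) 0 i =
    ((enum_val i == (l, m)) + (enum_val i == (m, l)))%:R.
Proof.
rewrite mxE !coeffU !mul1r (eq_sym _ (enum_val i)) natrD rmorphD /= !rmorph_nat.
case: (enum_val i) => x y; rewrite /swap /= !xpair_eqE.
by rewrite (eq_sym l) (eq_sym m) (andbC (y == l)).
Qed.

Definition sum_relator (m : 'I_r) : F r := \sum_(l < r | l != m) b l m *~ k l.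

(** A weighted unsigned incidence matrix: the column of an edge {l, m} has [k m] in row [l], [k l]
    in row [m], and zeros elsewhere. *)
Definition sum_relator_mx : 'M[rat]_(r, #|oriented_edges|) :=
  \matrix_m edge_coord (sum_relator m).

Let G := subgroup_gen (relator e k).

Lemma relator_in_subgroup x : relator e k x -> x \in G.
Proof. by move=> kx; apply/asboolP => H _; apply. Qed.

Lemma freeg_sum_pairs (x : F r) : x = \sum_p b p.1 p.2 *~ coeff p x.
Proof.
apply/eqP/freeg_eqP => q; rewrite raddf_sum /= (bigD1 q) //= big1 ?addr0.
  rewrite raddfMz /= coeffU -surjective_pairing eqxx mulr1.
  by rewrite -mulrzl mulr1 intz.
move=> p pq; rewrite raddfMz /= coeffU -surjective_pairing (negPf pq).
by rewrite mulr0 mul0rz.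
Qed.

(** Diagonal symbols are relators by irreflexivity. Up to a symmetry relator, the terms at (l, m)
    and (m, l) add up to [b l m] times the sum of their coefficients; this sum is zero on an edge,
    and [b l m] is itself a relator otherwise. *)
Lemma edge_coord_eq0 (x : F r) : edge_coord x = 0 -> x \in G.
Proof.
move=> /rowP x0; rewrite [x]freeg_sum_pairs.
rewrite (bigID (fun p : 'I_r * 'I_r => p.1 < p.2)%N) /= addrC.
rewrite (bigID (fun p : 'I_r * 'I_r => p.1 == p.2)) /= -addrA.
apply: rpredD.
  apply: rpred_sum => -[l m] /= /andP[_ /eqP <-]; apply: rpredMz.
  by apply: relator_in_subgroup; constructor; rewrite e_irrefl.
rewrite (reindex_inj (h := swap)) /=; last by move=> [? ?] [? ?] [-> ->].
rewrite (eq_bigl (fun p : 'I_r * 'I_r => p.1 < p.2)%N); last first.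
  by move=> p /=; rewrite -leqNgt ltn_neqAle andbC eq_sym.
rewrite -big_split /=; apply: rpred_sum => -[l m] /= lt_lm.
have -> : b m l *~ coeff (m, l) x + b l m *~ coeff (l, m) x =
  b l m *~ (coeff (l, m) x + coeff (m, l) x)
    - (b l m - b m l) *~ coeff (m, l) x.
  by rewrite mulrzDr mulrzBl opprB addrACA subrr addr0 addrC.
apply: rpredB; last first.
  by apply: rpredMz; apply: relator_in_subgroup; constructor.
have [elm|nelm] := boolP (e l m); last first.
  by apply: rpredMz; apply: relator_in_subgroup; constructor.
have lmP : (l, m) \in oriented_edges by rewrite inE lt_lm.
have := x0 (enum_rank_in lmP (l, m)); rewrite !mxE enum_rankK_in // => /eqP.
by rewrite intr_eq0 => /eqP ->; rewrite mulr0z rpred0.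
Qed.

(** The cokernel matrix kills exactly the row space of [sum_relator_mx], so the third relators
    vanish too. This is the map [T] fed to [has_rank_quot]. *)
Definition relator_coker (x : F r) := edge_coord x *m cokermx sum_relator_mx.

Fact relator_coker_is_zmod_morphism : zmod_morphism relator_coker.
Proof. by move=> x y; rewrite /relator_coker raddfB mulmxBl. Qed.
HB.instance Definition _ := GRing.isZmodMorphism.Build (F r)
  'rV[rat]_#|oriented_edges| relator_coker relator_coker_is_zmod_morphism.

Lemma relator_coker_relator x : relator e k x -> relator_coker x = 0.
Proof.
have E0 y : edge_coord y = 0 -> relator_coker y = 0.
  by rewrite /relator_coker => ->; rewrite mul0mx.
case=> [l m lm|l m nlm|m].
- apply: E0; rewrite raddfB; apply/eqP; rewrite subr_eq0; apply/eqP/rowP => i.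
  by rewrite !edge_coord_b addnC.
- apply: E0; apply/rowP => i; rewrite edge_coord_b mxE.
  have := enum_valP i; rewrite inE => /andP[_ ei].
  case: eqP ei => [->|_] /=; first by rewrite (negPf nlm).
  by case: eqP => [->|_] //=; rewrite e_sym (negPf nlm).
- rewrite /relator_coker -/(sum_relator m).
  have -> : edge_coord (sum_relator m) = row m sum_relator_mx by rewrite rowK.
  by rewrite -row_mul mulmx_coker row0.
Qed.

(** If the image is zero, [edge_coord x] is a rational combination of rows of [sum_relator_mx];
    after clearing denominators, [x *~ d] differs from an integer combination of third relators by
    an element with zero edge coordinates. Conversely, the kernel is a subgroup containing all
    relators, and the rational target has no torsion. *)
Lemma relator_coker_eq0 x :
  relator_coker x = 0 <-> exists2 d : int, d != 0 & x *~ d \in G.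
Proof.
split=> [/eqP|[d d_neq0 /asboolP xG]]; last first.
  have : x *~ d \in [pred y | relator_coker y == 0].
    apply: xG => [|y /relator_coker_relator Ty0]; last by rewrite inE Ty0.
    split=> [|y z]; rewrite !inE ?raddf0 // => /eqP y0 /eqP z0.
    by rewrite raddfB /= y0 z0 subr0.
  rewrite inE raddfMz -scaler_int scaler_eq0 intr_eq0 (negPf d_neq0).
  by move/eqP.
rewrite /relator_coker -submxE => /submxP[y xE].
have [d d_neq0 [z zE]] := rV_clear_denominators y.
exists d => //; rewrite -[x *~ d](subrK (\sum_m sum_relator m *~ z m)).
apply: rpredD; last first.
  apply: rpred_sum => m _; apply: rpredMz; apply: relator_in_subgroup.
  by constructor.
apply: edge_coord_eq0; rewrite raddfB raddfMz raddf_sum /= xE; apply/eqP.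
rewrite subr_eq0 -scaler_int scalemxAl mulmx_sum_row; apply/eqP.
by apply: eq_bigr => m _; rewrite rowK mxE zE raddfMz scaler_int.
Qed.

Lemma has_rank_D : has_rank (D e k) (#|edges e| - \rank sum_relator_mx).
Proof.
rewrite -card_oriented_edges -mxrank_coker.
apply: (@has_rank_quot _ G _ _ relator_coker
  (fun i => b (enum_val i).1 (enum_val i).2)).
- by move=> x; apply: submxMl.
- move=> i; rewrite [RHS]rowE; congr (_ *m _).
  apply/rowP => j; rewrite edge_coord_b mxE eqxx /= -surjective_pairing.
  (* The reverse of an oriented edge is not oriented, so the edge coordinates of the chosen symbol
     form the [i]-th unit vector. *)
  have /negPf -> : enum_val j != ((enum_val i).2, (enum_val i).1).
    have := enum_valP i; have := enum_valP j; rewrite !inE.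
    move=> /andP[+ _] /andP[lt_i _]; apply: contraTneq => -> /=.
    by rewrite -leqNgt ltnW.
  by rewrite (inj_eq enum_val_inj) addn0.
- exact: relator_coker_eq0.
Qed.

Lemma mul_sum_relator_mx (y : 'rV[rat]_r) i (p := enum_val i) :
  (y *m sum_relator_mx) 0 i =
    y 0 p.2 * (k p.1)%:~R + y 0 p.1 * (k p.2)%:~R.
Proof.
have := enum_valP i; rewrite -/p inE => /andP[_ ep].
(* This keeps the term [l = p.1] in the relator of [p.2], and vice versa, despite the condition
   [l != m]. *)
have neq_p : p.1 != p.2 by apply: contraTneq ep => ->; rewrite e_irrefl.
have entry m : sum_relator_mx m i =
    (m == p.2)%:R * (k p.1)%:~R + (m == p.1)%:R * (k p.2)%:~R.
  rewrite mxE raddf_sum summxE.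
  rewrite (eq_bigr (fun l => (m == p.2)%:R * ((l == p.1)%:R * (k l)%:~R)
      + (m == p.1)%:R * ((l == p.2)%:R * (k l)%:~R))); last first.
    move=> l lm; rewrite raddfMz /= -scaler_int mxE edge_coord_b -/p.
    rewrite mulrC natrD mulrDl.
    rewrite [p]surjective_pairing !xpair_eqE !(eq_sym (p.1)) !(eq_sym (p.2)).
    by rewrite -!mulnb !natrM !mulrA (mulrC (l == p.1)%:R).
  rewrite big_split /= -!big_distrr /=; congr (_ + _).
    case: (eqVneq m p.2) => [->|]; last by rewrite !mul0r.
    rewrite (bigD1 p.1) //= eqxx !mul1r big1 ?addr0 // => l /andP[_ lp].
    by rewrite (negPf lp) mul0r.
  case: (eqVneq m p.1) => [->|]; last by rewrite !mul0r.
  rewrite (bigD1 p.2) ?(eq_sym p.2) //= eqxx !mul1r big1 ?addr0 //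
    => l /andP[_ lp].
  by rewrite (negPf lp) mul0r.
rewrite mxE (eq_bigr (fun m => (y 0 m * (m == p.2)%:R) * (k p.1)%:~R
    + (y 0 m * (m == p.1)%:R) * (k p.2)%:~R)); last first.
  by move=> m _; rewrite entry mulrDr !mulrA.
rewrite big_split /= -!big_distrl /=.
have sum1 q : \sum_m y 0 m * (m == q)%:R = y 0 q.
  rewrite (bigD1 q) //= eqxx mulr1 big1 ?addr0 // => l lq.
  by rewrite (negPf lq) mulr0.
by rewrite !sum1.
Qed.

Lemma ker_sum_relator_mxP (y : 'rV[rat]_r) :
  y *m sum_relator_mx = 0 <->
  forall l m, e l m -> y 0 l * (k m)%:~R + y 0 m * (k l)%:~R = 0.
Proof.
split=> [y0 l m elm|y0].
  wlog lt_lm : l m elm / (l < m)%N.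
    move=> wl; case: (ltngtP l m) => [|lt_ml|/ord_inj eq_lm]; first exact: wl.
      by rewrite addrC wl // e_sym.
    by move: elm; rewrite eq_lm e_irrefl.
  have lmP : (l, m) \in oriented_edges by rewrite inE lt_lm.
  have := mul_sum_relator_mx y (enum_rank_in lmP (l, m)).
  by rewrite y0 mxE enum_rankK_in //= addrC => <-.
apply/rowP => i; rewrite mul_sum_relator_mx mxE addrC y0 //.
by have := enum_valP i; rewrite inE => /andP[].
Qed.

End Relators.

(** * The row kernel and the bipartite components *)

Section Components.
Variables (r : nat) (e : rel 'I_r) (k : 'I_r -> int).
Hypotheses (e_sym : symmetric e) (e_irrefl : irreflexive e).
Hypothesis k_neq0 : forall l, k l != 0.

Lemma component_connect C x y :
  C \in components e -> x \in C -> (y \in C) = connect e x y.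
Proof.
case/imsetP => x0 _ ->; rewrite !inE /= => x0x.
by rewrite (same_connect (sym_connect_sym e_sym) x0x).
Qed.

Lemma component_edge C l m :
  C \in components e -> e l m -> (l \in C) = (m \in C).
Proof.
move=> CP elm; apply/idP/idP => [lC|mC].
  by rewrite (component_connect _ CP lC) connect1.
by rewrite (component_connect _ CP mC) connect1 // e_sym.
Qed.

Lemma component_neq0 C : C \in components e -> exists x, x \in C.
Proof. by case/imsetP => x _ ->; exists x; rewrite !inE connect0. Qed.

Lemma component_eq C C' x :
  C \in components e -> C' \in components e -> x \in C -> x \in C' -> C = C'.
Proof.
move=> CP CP' xC xC'; apply/setP => y.
by rewrite (component_connect _ CP xC) (component_connect _ CP' xC').
Qed.

Lemma connect_invariant (X : Type) (f : 'I_r -> X) x y :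
  (forall l m, e l m -> f l = f m) -> connect e x y -> f x = f y.
Proof.
move=> fe /connectP[p + ->]; elim: p x => //= z p IH x /andP[exz /IH <-].
exact: fe.
Qed.

(** Fixes one 2-colouring for each bipartite component; the default [set0] is the value when [C] is
    not bipartite. *)
Definition colour_class (C : {set 'I_r}) : {set 'I_r} :=
  odflt set0 [pick A : {set 'I_r} |
    [forall x in C, forall y in C, e x y ==> ((x \in A) != (y \in A))]].

Definition sign C x : rat := (-1) ^+ (x \in colour_class C).

Lemma sign_neq0 C x : sign C x != 0.
Proof. by rewrite /sign signr_eq0. Qed.

Lemma sign_edge C x y :
  bipartite e C -> x \in C -> y \in C -> e x y -> sign C y = - sign C x.
Proof.
move=> bC xC yC exy; rewrite /sign /colour_class; case: pickP => [A|A0];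
  last by case/existsP: bC => A; rewrite A0.
move=> /forall_inP/(_ x xC)/forall_inP/(_ y yC)/implyP/(_ exy) /=.
by case: (x \in A); case: (y \in A); rewrite //= ?expr0 ?expr1 ?opprK.
Qed.

Definition bip_components := [set C in components e | bipartite e C].

(** The candidate kernel basis: the factor [k l] turns the signing of a component, extended by zero,
    back from z = y / k to y. *)
Definition signing_mx : 'M[rat]_(#|bip_components|, r) :=
  \matrix_(i < #|bip_components|, l < r)
    (if l \in enum_val i then sign (enum_val i) l * (k l)%:~R else 0).

Let bipP (i : 'I_#|bip_components|) :
  enum_val i \in components e /\ bipartite e (enum_val i).
Proof. by have := enum_valP i; rewrite inE => /andP. Qed.

Let kQ_neq0 l : (k l)%:~R != 0 :> rat.
Proof. by rewrite intr_eq0. Qed.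

(** Components are disjoint, so only row [i] is nonzero at a vertex of component [i]. *)
Lemma mul_signing_mx (v : 'rV[rat]_#|bip_components|)
    (i : 'I_#|bip_components|) x : x \in enum_val i ->
  (v *m signing_mx) 0 x = v 0 i * (sign (enum_val i) x * (k x)%:~R).
Proof.
move=> xi; rewrite mxE (bigD1 i) //= mxE xi big1 ?addr0 // => j ji.
rewrite mxE ifN ?mulr0 //; apply: contraNN ji => xj; apply/eqP/enum_val_inj.
exact: component_eq (proj1 (bipP j)) (proj1 (bipP i)) xj xi.
Qed.

Lemma signing_mx_free : row_free signing_mx.
Proof.
apply: inj_row_free => v v0; apply/rowP => i.
have [iP _] := bipP i; have [x xi] := component_neq0 iP.
have := mul_signing_mx v xi; rewrite v0 !mxE => /esym/eqP.
by rewrite !mulf_eq0 (negPf (sign_neq0 _ _)) (negPf (kQ_neq0 _)) !orbF => /eqP.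
Qed.

Let M := sum_relator_mx e k.

Lemma signing_mx_sub_ker : (signing_mx <= kermx M)%MS.
Proof.
apply/row_subP => i; apply/sub_kermxP/(ker_sum_relator_mxP _ e_sym e_irrefl).
move=> l m elm; rewrite !mxE; have [iP ib] := bipP i.
rewrite -(component_edge iP elm); case: ifP => li; last by rewrite !mul0r addr0.
have mi : m \in enum_val i by rewrite -(component_edge iP elm).
rewrite (sign_edge ib li mi elm) !mulNr -!mulrA (mulrC (k m)%:~R).
by rewrite subrr.
Qed.

Lemma ker_sub_signing_mx : (kermx M <= signing_mx)%MS.
Proof.
apply/row_subP => i0; set y := row i0 _.
have /(ker_sum_relator_mxP _ e_sym e_irrefl) yE : y *m M = 0.
  by rewrite -row_mul mulmx_ker row0.
pose z l := y 0 l / (k l)%:~R.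
have zE l m : e l m -> z m = - z l.
  move=> /yE; rewrite /z => /eqP; rewrite addrC addr_eq0 => /eqP yk.
  apply: (mulIf (kQ_neq0 m)); rewrite divfK //.
  apply: (mulIf (kQ_neq0 l)); rewrite yk !mulNr -!mulrA.
  by rewrite [_^-1 * _]mulrCA mulVf ?mulr1.
have yz l : y 0 l = z l * (k l)%:~R by rewrite divfK.
have z_nbip C x : C \in components e -> ~~ bipartite e C -> x \in C -> z x = 0.
  move=> CP nb xC; apply/eqP; apply: contraNT nb => zx_neq0.
  (* [z] has constant absolute value on [C], hence vanishes nowhere there, and its positive vertices
     form a colour class. *)
  apply/existsP; exists [set l | 0 < z l].
  apply/forall_inP => l lC; apply/forall_inP => m mC; apply/implyP => elm.
  have z_norm : `|z x| = `|z l|.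
    apply: (@connect_invariant _ (fun m => `|z m|));
      last by rewrite -(component_connect _ CP xC).
    by move=> a c /zE ->; rewrite normrN.
  have zl_neq0 : z l != 0 by rewrite -normr_eq0 -z_norm normr_eq0.
  by rewrite !inE (zE _ _ elm) oppr_gt0; case: ltrgtP zl_neq0.
(* [z] and [sign] both flip along an edge, so their product is constant on the component and any
   vertex may be picked; the default 0 is never reached, components being nonempty. *)
pose c : 'rV_#|bip_components| := \row_(i < #|bip_components|)
  (if [pick x in enum_val i] is Some x then z x * sign (enum_val i) x else 0).
apply/submxP; exists c; apply/rowP => l.
have CP : [set m | connect e l m] \in components e.
  by apply/imsetP; exists l => //; apply/setP => m; rewrite !inE.
have lC : l \in [set m | connect e l m] by rewrite inE connect0.
have [bC|nbC] := boolP (bipartite e [set m | connect e l m]); last first.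
  rewrite yz (z_nbip _ _ CP nbC lC) mul0r mxE big1 // => i _.
  rewrite [signing_mx _ _]mxE ifN ?mulr0 //; apply: contraNN nbC => li.
  by have [iP ib] := bipP i; rewrite -(component_eq iP CP li lC).
have CB : [set m | connect e l m] \in bip_components by rewrite inE CP.
pose i := enum_rank_in CB [set m | connect e l m].
have iE : enum_val i = [set m | connect e l m] by rewrite enum_rankK_in.
have li : l \in enum_val i by rewrite iE.
rewrite (mul_signing_mx _ li) yz mulrA; congr (_ * _); rewrite mxE.
case: pickP => [x xi|/(_ l)]; last by rewrite li.
have [iP ib] := bipP i.
(* Extension by zero makes the product invariant along every edge of the graph, as
   [connect_invariant] requires. *)
pose f m := if m \in enum_val i then z m * sign (enum_val i) m else 0.
have : f x = f l.
  apply: (@connect_invariant _ f); last by rewrite -(component_connect _ iP xi).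
  move=> a d ead; rewrite /f -(component_edge iP ead); case: ifP => // ai.
  have di : d \in enum_val i by rewrite -(component_edge iP ead).
  by rewrite (sign_edge ib ai di ead) (zE _ _ ead) mulrNN.
by rewrite /f xi li => ->; rewrite -mulrA /sign -expr2 sqrr_sign mulr1.
Qed.

Lemma rank_sum_relator_mx : (\rank M + #|bip_components|)%N = r.
Proof.
have : \rank (kermx M) = #|bip_components|.
  apply/eqP; rewrite -(eqP signing_mx_free) eqn_leq.
  by rewrite !mxrankS ?ker_sub_signing_mx ?signing_mx_sub_ker.
by rewrite mxrank_ker => <-; rewrite subnKC ?rank_leq_row.
Qed.

End Components.

Theorem corollary49 (r : nat) (e : rel 'I_r) (k : 'I_r -> int)
    (e_sym : symmetric e) (e_irrefl : irreflexive e)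
    (k_ge1 : forall l : 'I_r, 1 <= k l) :
  let s := #|edges e| in
  let t := #|[set C in components e | bipartite e C]| in
  exists n : nat, has_rank (D e k) n /\ n%:Z = s%:Z - r%:Z + t%:Z.
Proof.
move=> s t; exists (s - \rank (sum_relator_mx e k))%N; split.
  exact: has_rank_D.
have k_neq0 l : k l != 0 by apply: contraTneq (k_ge1 l) => ->.
(* With this bound the truncated subtraction in the witness agrees with subtraction of integers. *)
have rank_le : (\rank (sum_relator_mx e k) <= s)%N.
  by rewrite /s -(card_oriented_edges e_sym e_irrefl) rank_leq_col.
have r_eq : r%:Z = (\rank (sum_relator_mx e k))%:Z + t%:Z.
  by rewrite -PoszD (rank_sum_relator_mx e_sym e_irrefl k_neq0).
by rewrite r_eq -subzn // opprD addrA addrNK.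
Qed.
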